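(* For every finite tree $T$, the spectrum of the combinatorial Laplacian of $T$ is majorized by the conjugate degree sequence of $T$, i.e. $\lambda(T)\unlhd d^T(T)$.
   Context: For a finite simple graph $X$ with $n$ vertices $v_1,\dots,v_n$, the combinatorial Laplacian $L(X)$ is the $n\times n$ matrix with $L(X)_{ii}=\deg(v_i)$, $L(X)_{ij}=-1$ if $\{v_i,v_j\}$ is an edge, and $L(X)_{ij}=0$ otherwise. It is positive semidefinite, and $\lambda(X)=(\lambda_1\ge\lambda_2\ge\dots\ge\lambda_n=0)$ denotes its eigenvalues listed in non-increasing order with multiplicity. The degree sequence $d(X)$ is the sequence of vertex degrees of $X$ in non-increasing order. Its conjugate $d^T(X)$ (the superscript $T$ here denotes conjugation, not the tree) is the sequence with $d^T_j(X)=|\{v : \deg_X(v)\ge j\}|$ for $1\le j\le n$. For non-increasing real sequences $s,t$ of length $n$, $s\unlhd t$ (''$s$ is majorized by $t$'') means $\sum_{i=1}^k s_i\le\sum_{i=1}^k t_i$ for all $k\le n$, and $\sum_{i=1}^n s_i=\sum_{i=1}^n t_i$. *)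

(* Defs.v *)
From mathcomp Require Import all_boot all_order all_algebra.
From mathcomp Require Import complex.

Set Implicit Arguments.
Unset Strict Implicit.
Unset Printing Implicit Defensive.

Import Order.TTheory GRing.Theory Num.Theory.
Local Open Scope ring_scope.

Definition simple_graph (V : finType) (e : rel V) : Prop :=
  symmetric e /\ irreflexive e.

Definition connected_graph (V : finType) (e : rel V) : Prop :=
  (0 < #|V|)%N /\ forall x y : V, connect e x y.

(* A closed walk x, y, x of length 2 along one edge satisfies [ucycle], whence
   the lower bound 3 on the length of a genuine graph cycle. *)
Definition acyclic_graph (V : finType) (e : rel V) : Prop :=
  forall c : seq V, (2 < size c)%N -> ~ ucycle e c.

Definition tree (V : finType) (e : rel V) : Prop :=
  [/\ simple_graph e, connected_graph e & acyclic_graph e].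

Definition deg (V : finType) (e : rel V) (v : V) : nat := #|[set w | e v w]|.

(* The vertices are numbered by the canonical enumeration [enum_val] of [V]. *)
Definition laplacian (R : pzRingType) (V : finType) (e : rel V) : 'M[R]_#|V| :=
  \matrix_(i, j)
    if i == j then (deg e (enum_val i))%:R
    else if e (enum_val i) (enum_val j) then -1 else 0.

Definition is_spectrum (R : rcfType) (n : nat) (A : 'M[R]_n) (s : seq R) : Prop :=
  sorted >=%R s /\ char_poly A = \prod_(x <- s) ('X - x%:P).

(* The entry of 0-based index j is d^T_(j+1), the number of v with
   deg v >= j + 1. *)
Definition conj_degree (R : pzSemiRingType) (V : finType) (e : rel V) : seq R :=
  mkseq (fun j => #|[set v | (j < deg e v)%N]|%:R) #|V|.

Definition majorized (R : rcfType) (s t : seq R) : Prop :=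
  [/\ sorted >=%R s, sorted >=%R t, size s = size t,
      forall k : nat, (k <= size s)%N ->
        \sum_(x <- take k s) x <= \sum_(x <- take k t) x
    & \sum_(x <- s) x = \sum_(x <- t) x].

(* [is_spectrum] determines the list of eigenvalues, and every real symmetric
   matrix, in particular every Laplacian, has such a list. *)
Lemma is_spectrum_uniq (R : rcfType) (n : nat) (A : 'M[R]_n) (s t : seq R) :
  is_spectrum A s -> is_spectrum A t -> s = t.
Proof.
move=> [s_sorted As] [t_sorted At].
apply: (sorted_eq ge_trans ge_anti) => //.
by apply: prod_XsubC_eq; rewrite -As -At.
Qed.

Lemma laplacian_sym (R : pzRingType) (V : finType) (e : rel V) :
  symmetric e -> (laplacian R e)^T = laplacian R e.
Proof.
move=> e_sym; apply/matrixP=> i j; rewrite !mxE eq_sym e_sym.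
by case: eqP => // ->.
Qed.

Lemma char_poly_conj (F : fieldType) (n : nat) (P D : 'M[F]_n) :
  P \in unitmx -> char_poly (invmx P *m D *m P) = char_poly D.
Proof.
move=> P_unit; pose lift := map_mx (@polyC F) : 'M_n -> 'M_n.
have PV : lift (invmx P) *m lift P = 1%:M.
  by rewrite -map_mxM mulVmx // map_mx1.
rewrite /char_poly /char_poly_mx !map_mxM -/lift.
have -> : 'X%:M - lift (invmx P) *m lift D *m lift P =
          lift (invmx P) *m ('X%:M - lift D) *m lift P.
  rewrite mulmxBr mulmxBl; congr (_ - _).
  by rewrite mul_mx_scalar -scalemxAl PV scale_scalar_mx mulr1.
by rewrite !det_mulmx mulrAC -det_mulmx PV det1 mul1r.
Qed.

Lemma is_spectrum_exists (R : rcfType) (n : nat) (A : 'M[R]_n) :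
  A^T = A -> exists s, is_spectrum A s.
Proof.
move=> A_sym; pose f := real_complex R; pose B := map_mx f A.
have B_real : B \is a mxOver Num.real.
  apply/mxOverP=> i j; by rewrite mxE complex_real.
have B_herm : B \is hermsymmx.
  apply: realsym_hermsym => //.
  by apply/is_hermitianmxP; rewrite expr0 scale1r map_mx_id // map_trmx A_sym.
have /orthomx_spectralP B_eq := hermitian_normalmx B_herm.
have /mxOverP d_real := hermitian_spectral_diag_real B_herm.
set P := spectralmx B in B_eq; set d := spectral_diag B in B_eq d_real.
pose r := [seq complex.Re (d 0 i) | i <- enum 'I_n].
exists (sort >=%R r); split; first exact/sort_sorted/ge_total.
have r_prod : map_poly f (\prod_(x <- r) ('X - x%:P)) =
    \prod_(i < n) ('X - (d 0 i)%:P).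
  rewrite big_map big_enum rmorph_prod; apply: eq_bigr => i _.
  by rewrite rmorphB /= map_polyX map_polyC /= RRe_real.
apply: (map_poly_inj f); rewrite map_char_poly -/B.
rewrite (perm_big r) /=; last by rewrite perm_sort.
rewrite r_prod B_eq char_poly_conj ?spectral_unit //.
rewrite char_poly_trig ?diag_mx_is_trig //.
by apply: eq_bigr => i _; rewrite mxE eqxx mulr1n.
Qed.

(* Main.v *)
(** The sum of the k largest eigenvalues is the Laplacian form summed over an
    orthonormal frame of k top eigenvectors. The energy of an edge, summed over the frame,
    is at most 2 by Bessel's inequality, and that of a star with centre b and
    d leaves is at most d + pi(b) + sum of pi over the leaves, where pi(v) is
    the squared norm of the frame at v, of total mass k; for the star Laplacian
    is at most d times a rank one projection plus the identity on the star.

    Let B be the set of the p vertices of degree at least k, let c be the number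
    of edges inside B, and cut the tree into the edges inside B, the edges
    inside the complement of B, and for each b in B the star of edges from b to
    the complement. A vertex s outside B lies in m(s) stars, and since B with s
    spans a forest, c + m(s) <= p. Hence the pi terms of the stars add up to at
    most k (p - c), which for k >= 2 leaves room for the energy 2c of the edges
    inside B. For k = 1 one uses that no Laplacian eigenvalue exceeds the number
    of vertices. *)
Require Import Defs.
From mathcomp Require Import all_boot all_order all_algebra.
From mathcomp Require Import complex zify ring lra.
Set Implicit Arguments.
Unset Strict Implicit.
Unset Printing Implicit Defensive.
Import Order.TTheory GRing.Theory Num.Theory.
Local Open Scope ring_scope.

(** * Frames of top eigenvectors of a real symmetric matrix *)

Lemma Re_sum (R : rcfType) (I : Type) (r : seq I) (F : I -> R[i]) :
  complex.Re (\sum_(i <- r) F i) = \sum_(i <- r) complex.Re (F i).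
Proof. by apply: (big_morph (@complex.Re R)) => // -[a b] [c d]. Qed.

Lemma Im_sum (R : rcfType) (I : Type) (r : seq I) (F : I -> R[i]) :
  complex.Im (\sum_(i <- r) F i) = \sum_(i <- r) complex.Im (F i).
Proof. by apply: (big_morph (@complex.Im R)) => // -[a b] [c d]. Qed.

(** This transports the order of the eigenvalue list to the indices of the eigenvectors, so that
    [take k] on both selects matching pairs. *)
Lemma perm_map_lift (T U : eqType) (f : T -> U) (s : seq U) (t : seq T) :
  perm_eq s (map f t) -> exists2 t', perm_eq t' t & s = map f t'.
Proof.
case: t => [|x0 t]; first by move/perm_nilP=> ->; exists [::].
move: (x0 :: t) => u /(perm_iotaP (f x0))[I]; rewrite size_map => I_perm sE.
exists [seq nth x0 u i | i <- I].
  by rewrite -[X in perm_eq _ X](mkseq_nth x0) perm_map.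
rewrite sE -map_comp; apply/eq_in_map => i.
by rewrite (perm_mem I_perm) mem_iota /= => lt_i; rewrite (nth_map x0).
Qed.

(* The frame consists of the real and imaginary parts of k complex unit
   eigenvectors, so that it has 2k members but total squared norm k. *)
Lemma spectral_frame (R : rcfType) (n : nat) (A : 'M[R]_n) (lam : seq R)
    (k : nat) :
  A^T = A -> is_spectrum A lam -> (k <= n)%N ->
  exists r : seq 'rV[R]_n,
    [/\ forall x : 'rV_n,
          \sum_(y <- r) (\sum_j y 0 j * x 0 j) ^+ 2 <= \sum_j x 0 j ^+ 2,
        \sum_(y <- r) \sum_j y 0 j ^+ 2 = k%:R
      & \sum_(y <- r) \sum_i \sum_j y 0 i * A i j * y 0 j =
          \sum_(x <- take k lam) x].
Proof.
move=> A_sym [_ lamE] le_kn; pose f := real_complex R; pose B := map_mx f A.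
have B_real : B \is a mxOver Num.real.
  by apply/mxOverP=> i j; rewrite mxE complex_real.
have B_herm : B \is hermsymmx.
  apply: realsym_hermsym => //.
  by apply/is_hermitianmxP; rewrite expr0 scale1r map_mx_id // map_trmx A_sym.
have /orthomx_spectralP B_eq := hermitian_normalmx B_herm.
have /mxOverP d_real := hermitian_spectral_diag_real B_herm.
have P_unit := spectral_unitarymx B.
set P := spectralmx B in B_eq P_unit; set d := spectral_diag B in B_eq d_real.
have PV := invmx_unitary P_unit.
have PPt : P *m (map_mx Num.conj P^T) = 1%:M by apply/unitarymxP.
have PtP : (map_mx Num.conj P^T) *m P = 1%:M.
  by rewrite -PV mulVmx // spectral_unit.
have PBP : P *m B *m map_mx Num.conj P^T = diag_mx d.
  by rewrite B_eq PV !mulmxA PPt mul1mx -mulmxA PPt mulmx1.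
have lam_perm : perm_eq lam [seq complex.Re (d 0 i) | i <- enum 'I_n].
  apply: prod_XsubC_eq; rewrite -lamE; apply: (map_poly_inj f).
  rewrite map_char_poly -/B B_eq char_poly_conj ?spectral_unit //.
  rewrite char_poly_trig ?diag_mx_is_trig // big_map big_enum rmorph_prod.
  apply: eq_bigr => i _; rewrite mxE eqxx mulr1n.
  by rewrite rmorphB /= map_polyX map_polyC /= RRe_real.
have [s s_perm lam_s] : exists2 s, perm_eq s (enum 'I_n)
    & lam = [seq complex.Re (d 0 i) | i <- s].
  exact: perm_map_lift.
have size_s : size s = n by rewrite (perm_size s_perm) size_enum_ord.
exists ([seq map_mx (@complex.Re R) (row i P) | i <- take k s] ++
        [seq map_mx (@complex.Im R) (row i P) | i <- take k s]).
split=> [x||]; rewrite big_cat !big_map /= -big_split /=.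
(* The two frame members coming from row i together contribute |z i|^2, and over all rows these add
   up to the squared norm of x, as [P] is unitary. *)
- pose z i := \sum_j P i j * (x 0 j)%:C%C.
  have zE i : (\sum_j (map_mx (@complex.Re R) (row i P)) 0 j * x 0 j) ^+ 2 +
      (\sum_j (map_mx (@complex.Im R) (row i P)) 0 j * x 0 j) ^+ 2
      = complex.Re ((z i)^* * z i).
    have -> : \sum_j (map_mx (@complex.Re R) (row i P)) 0 j * x 0 j =
        complex.Re (z i).
      rewrite Re_sum; apply: eq_bigr => j _; rewrite !mxE.
      by case: (P i j) => a b /=; ring.
    have -> : \sum_j (map_mx (@complex.Im R) (row i P)) 0 j * x 0 j =
        complex.Im (z i).
      rewrite Im_sum; apply: eq_bigr => j _; rewrite !mxE.
      by case: (P i j) => a b /=; ring.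
    by case: (z i) => a b /=; ring.
  rewrite (eq_bigr _ (fun i _ => zE i)).
  apply: (@le_trans _ _ (\sum_(i <- s) complex.Re ((z i)^* * z i))).
    rewrite -[X in _ <= \sum_(i <- X) _](cat_take_drop k s) big_cat /= lerDl.
    by apply: sumr_ge0 => i _; rewrite -zE addr_ge0 ?sqr_ge0.
  rewrite (perm_big _ s_perm) big_enum /=.
  pose X : 'cV[R[i]]_n := \col_j (x 0 j)%:C%C.
  have zX : P *m X = \col_i z i.
    by apply/matrixP=> i j; rewrite !mxE; apply: eq_bigr => l _; rewrite !mxE.
  have XX : map_mx Num.conj (P *m X)^T *m (P *m X) = map_mx Num.conj X^T *m X.
    by rewrite trmx_mul map_mxM mulmxA -(mulmxA (map_mx _ _)) PtP mulmx1.
  have /(congr1 (fun M : 'M_1 => complex.Re (M 0 0))) := XX.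
  rewrite zX !mxE !Re_sum => zz.
  rewrite le_eqVlt; apply/orP; left; apply/eqP.
  transitivity (\sum_i complex.Re ((map_mx Num.conj X^T) 0 i * X i 0)).
    by rewrite -zz; apply: eq_bigr => i _; rewrite !mxE.
  by apply: eq_bigr => i _; rewrite !mxE /= mulr0 subr0 expr2.
- transitivity (\sum_(i <- take k s) (1 : R)).
    apply: eq_bigr => i _; rewrite -big_split /=.
    have /(congr1 (fun M : 'M_n => complex.Re (M i i))) := PPt.
    rewrite !mxE eqxx Re_sum /= => <-; apply: eq_bigr => j _; rewrite !mxE.
    by case: (P i j) => a b /=; ring.
  rewrite big_const_seq count_predT size_take size_s iter_addr_0.
  by case: ltngtP le_kn => // ->.
(* The real part of the i-th diagonal entry in [PBP] is the form of [A] at the real part of row i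
   plus that at the imaginary part: [A] is real, so the mixed terms are purely imaginary. *)
- rewrite lam_s -map_take big_map; apply: eq_bigr => i _.
  have /(congr1 (fun M : 'M_n => complex.Re (M i i))) := PBP.
  rewrite [diag_mx _ _ _]mxE eqxx mulr1n => <-.
  rewrite mxE Re_sum exchange_big [X in _ + X]exchange_big -big_split /=.
  apply: eq_bigr => j _; rewrite !mxE mulr_suml Re_sum -big_split /=.
  by apply: eq_bigr => l _; rewrite !mxE; case: (P i j) (P i l) => a b [c e] /=; ring.
Qed.

(** * Edge counts in forests *)

Section Forest.
Variables (V : finType) (e : rel V).
Hypotheses (e_sym : symmetric e) (e_irr : irreflexive e).
Hypothesis e_acyclic : acyclic_graph e.

Definition nbrs (W : {set V}) (v : V) : {set V} := [set w in W | e v w].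

(* Otherwise a simple path in W could be extended forever: its end has a
   neighbour off the previous vertex, which closes no cycle. *)
Lemma exists_leaf (W : {set V}) :
  W != set0 -> exists2 v, v \in W & (#|nbrs W v| <= 1)%N.
Proof.
move=> /set0Pn[v0 v0W]; apply/exists_inP; apply: contraT.
rewrite negb_exists_in => /forall_inP min_deg; exfalso.
have long_path m : exists x p,
    [/\ size p = m, uniq (x :: p), path e x p & all (mem W) (x :: p)].
  elim: m => [|m [x [p [size_p Up ep Wp]]]].
    by exists v0, [::]; rewrite /= v0W.
  have /andP[xW pW] := Wp.
  (* For empty [p] the default makes [head x p] equal to x, which is no neighbour of itself, so the
     condition is harmless. *)
  have [z zW /andP[exz z_head]] :
      exists2 z, z \in W & e x z && (z != head x p).
    have := min_deg x xW; rewrite -ltnNge => /card_gt1P[a [b []]].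
    rewrite !inE => /andP[aW ea] /andP[bW eb] neq_ab.
    have [a_head|] := eqVneq a (head x p); last by exists a; rewrite ?ea.
    by exists b => //; rewrite eb -a_head eq_sym.
  have z_neq_x : z != x by apply: contraTneq exz => ->; rewrite e_irr.
  have [zp|zp] := boolP (z \in p); last first.
    exists z, (x :: p); rewrite /= size_p e_sym exz ep inE negb_or zp.
    by rewrite z_neq_x zW; split.
  case: p size_p Up ep Wp pW z_head zp => // y p _ Up ep _ _ /= z_neq_y.
  rewrite inE (negPf z_neq_y) /= => zp.
  case/splitPr: zp Up ep => p1 p2 Up ep.
  (* The edge from z back to x closes a cycle, of length at least 3 because z differs from y. *)
  case: (@e_acyclic (x :: y :: rcons p1 z)); first by rewrite /= size_rcons.
  move: Up ep; rewrite -cat_rcons => Up ep; apply/andP; split.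
    move: ep; rewrite /= rcons_path !cat_path last_rcons [e z x]e_sym exz andbT.
    by case/and3P=> -> ->.
  by move: Up; rewrite -!cat_cons cat_uniq => /andP[].
have [x [p [size_p Up _ _]]] := long_path #|V|.
by have := max_card (mem (x :: p)); rewrite (card_uniqP Up) /= size_p ltnn.
Qed.

Lemma nbrs_setU1 (W : {set V}) v : nbrs (v |: W) v = nbrs W v.
Proof.
by apply/setP=> w; rewrite !inE; case: eqVneq => // ->; rewrite e_irr !andbF.
Qed.

Lemma sum_card_nbrs_setU1 (W : {set V}) v : v \notin W ->
  (\sum_(u in v |: W) #|nbrs (v |: W) u| =
     2 * #|nbrs W v| + \sum_(u in W) #|nbrs W u|)%N.
Proof.
move=> vW; rewrite big_setU1 //= nbrs_setU1 mul2n -addnn -addnA.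
congr (_ + _)%N.
have -> : #|nbrs W v| = (\sum_(u in W) e v u)%N.
  rewrite -sum1dep_card big_mkcondr; apply: eq_bigr => u _.
  by case: (e v u).
rewrite -big_split; apply: eq_bigr => u _ /=.
rewrite (cardsD1 v) !inE eqxx e_sym; congr (_ + _)%N.
apply: eq_card => w; rewrite !inE; case: eqVneq => // ->.
by rewrite (negPf vW).
Qed.

(** Removing a leaf loses at most one edge, hence at most 2 from the degree sum. That sum is twice
    the number of edges within [W], so the bound is the usual one for forests, doubled. *)
Lemma card_nbrs_leq (W : {set V}) :
  W != set0 -> (\sum_(v in W) #|nbrs W v| + 2 <= 2 * #|W|)%N.
Proof.
have [m] := ubnP #|W|; elim: m W => // m IHm W; rewrite ltnS => le_Wm W0.
have [v vW] := exists_leaf W0; have vW' : v \notin W :\ v by rewrite !inE eqxx.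
move: le_Wm; rewrite -(setD1K vW) cardsU1 vW' nbrs_setU1 => le_Wm leaf_v.
rewrite sum_card_nbrs_setU1 //.
have [->|Wv0] := eqVneq (W :\ v) set0.
  rewrite big_set0 cards0 eq_card0 // => w.
  by rewrite !inE.
by rewrite mulnDr -addnA leq_add ?leq_mul ?IHm.
Qed.

End Forest.

(** * Energy bounds for edges, stars and complete graphs *)

Section Frame.
Variables (R : realFieldType) (V : finType) (r : seq (V -> R)).
Hypothesis bessel : forall x : V -> R,
  \sum_(y <- r) (\sum_v y v * x v) ^+ 2 <= \sum_v x v ^+ 2.

Definition edge_energy (u w : V) : R := \sum_(y <- r) (y u - y w) ^+ 2.
Definition weight (v : V) : R := \sum_(y <- r) y v ^+ 2.

Lemma weight_ge0 v : 0 <= weight v.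
Proof. by apply: sumr_ge0 => y _; exact: sqr_ge0. Qed.

Lemma edge_energy_ge0 u w : 0 <= edge_energy u w.
Proof. by apply: sumr_ge0 => y _; exact: sqr_ge0. Qed.

Lemma edge_energyC u w : edge_energy u w = edge_energy w u.
Proof. by apply: eq_bigr => y _; rewrite -sqrrN opprB. Qed.

Lemma sum_mul_delta (y : V -> R) u : \sum_v y v * (v == u)%:R = y u.
Proof.
rewrite (bigD1 u) //= eqxx mulr1 big1 ?addr0 // => v /negPf->.
by rewrite mulr0.
Qed.

Lemma sum_mul_ind (y : V -> R) (N : {set V}) :
  \sum_v y v * (v \in N)%:R = \sum_(v in N) y v.
Proof.
rewrite [RHS]big_mkcond; apply: eq_bigr => v _.
by case: (v \in N); rewrite ?mulr1 ?mulr0.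
Qed.

(** Bessel's inequality is applied to the vector with d at b and -1 on [N], of squared norm d (d +
    1); for d > 0 it is an eigenvector of the star Laplacian for the top eigenvalue d + 1.
    Multiplying through by d + 1 avoids normalising it. *)
Lemma star_energy_le (b : V) (N : {set V}) : b \notin N ->
  \sum_(w in N) edge_energy b w <= #|N|%:R + weight b + \sum_(w in N) weight w.
Proof.
move=> bN; set d : R := #|N|%:R; have d_ge0 : 0 <= d by apply: ler0n.
have d1_gt0 : 0 < d + 1 by apply: ltr_wpDl.
rewrite -(ler_pM2l d1_gt0) /edge_energy /weight.
rewrite exchange_big /= [\sum_(w in N) \sum_(y <- r) _]exchange_big /=.
have bessel_star := bessel (fun v => d * (v == b)%:R - (v \in N)%:R).
have lhsE (y : V -> R) : \sum_v y v * (d * (v == b)%:R - (v \in N)%:R) =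
    d * y b - \sum_(w in N) y w.
  under eq_bigr do rewrite mulrBr mulrCA.
  by rewrite sumrB -mulr_sumr sum_mul_delta sum_mul_ind.
have rhsE : \sum_v (d * (v == b)%:R - (v \in N)%:R) ^+ 2 = d ^+ 2 + d.
  have -> : \sum_v (d * (v == b)%:R - (v \in N)%:R) ^+ 2 =
      \sum_v d ^+ 2 * (v == b)%:R + \sum_v 1 * (v \in N)%:R.
    rewrite -big_split; apply: eq_bigr => v _ /=.
    by have [->|_] := eqVneq v b; [rewrite (negPf bN) | case: (v \in N)] => /=; ring.
  by rewrite (sum_mul_delta (fun=> d ^+ 2)) (sum_mul_ind (fun=> 1)) sumr_const.
rewrite rhsE (eq_bigr _ (fun y _ => congr1 (fun t => t ^+ 2) (lhsE y))) in bessel_star.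
rewrite -addrA mulrDr -big_split mulr_sumr /=.
have -> : (d + 1) * d = d ^+ 2 + d by ring.
apply: le_trans (lerD bessel_star (lexx _)); rewrite mulr_sumr -big_split /=.
apply: ler_sum => y _.
have -> : \sum_(w in N) (y b - y w) ^+ 2 =
    d * y b ^+ 2 - 2 * y b * (\sum_(w in N) y w) + \sum_(w in N) y w ^+ 2.
  rewrite mulr_sumr /d -sumr_const mulr_suml -sumrB -big_split /=.
  by apply: eq_bigr => w _; ring.
set S := \sum_(w in N) y w; set S2 := \sum_(w in N) _.
(* For each y the two sides differ by exactly (y b + S)^2. *)
by have := sqr_ge0 (y b + S); lra.
Qed.

(** Bessel's inequality for a difference of two basis vectors, of squared norm 2. *)
Lemma edge_energy_le2 u w : u != w -> edge_energy u w <= 2.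
Proof.
move=> neq_uw; have := bessel (fun v => (v == u)%:R - (v == w)%:R).
have lhsE (y : V -> R) : \sum_v y v * ((v == u)%:R - (v == w)%:R) = y u - y w.
  under eq_bigr do rewrite mulrBr.
  by rewrite sumrB !sum_mul_delta.
rewrite (eq_bigr _ (fun y _ => congr1 (fun t => t ^+ 2) (lhsE y))).
have -> : \sum_v ((v == u)%:R - (v == w)%:R) ^+ 2 =
    \sum_v 1 * (v == u)%:R + \sum_v 1 * (v == w)%:R :> R.
  rewrite -big_split; apply: eq_bigr => v _ /=.
  by have [->|_] := eqVneq v u; [rewrite (negPf neq_uw) | case: (v == w)] => /=; ring.
by rewrite !(sum_mul_delta (fun=> 1 : R)).
Qed.

(** Adding edges only increases the energy, and the complete graph on n vertices has the form n
    |y|^2 - (sum of y)^2. Ordered pairs count each edge twice, whence the 2. *)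
Lemma total_energy_le (e : rel V) :
  \sum_u \sum_(w | e u w) edge_energy u w <= 2 * #|V|%:R * \sum_v weight v.
Proof.
apply: (@le_trans _ _ (\sum_u \sum_w edge_energy u w)).
  apply: ler_sum => u _; rewrite big_mkcond; apply: ler_sum => w _.
  by case: ifP => // _; apply: edge_energy_ge0.
rewrite /edge_energy /weight (eq_bigr _ (fun u _ => exchange_big _ _ _ _ _ _)) /=.
rewrite exchange_big [\sum_v \sum_(y <- r) _]exchange_big mulr_sumr /=.
apply: ler_sum => y _.
have -> : \sum_i \sum_j (y i - y j) ^+ 2 =
    2 * #|V|%:R * (\sum_v y v ^+ 2) - 2 * (\sum_v y v) ^+ 2.
  have inner i : \sum_j (y i - y j) ^+ 2 =
      #|V|%:R * y i ^+ 2 - y i * (2 * \sum_v y v) + \sum_v y v ^+ 2.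
    rewrite mulrA mulr_sumr -sumr_const mulr_suml -sumrB -big_split /=.
    by apply: eq_bigr => j _; ring.
  rewrite (eq_bigr _ (fun i _ => inner i)) big_split sumrB /= sumr_const.
  by rewrite -mulr_sumr -mulr_suml -mulr_natl; ring.
by rewrite lerBlDr lerDl mulr_ge0 ?sqr_ge0.
Qed.

End Frame.

(** * The energy of a frame on a tree *)

Section Bound.
Variables (R : realFieldType) (V : finType) (e : rel V) (r : seq (V -> R)).
Hypothesis e_tree : tree e.
Hypothesis bessel : forall x : V -> R,
  \sum_(y <- r) (\sum_v y v * x v) ^+ 2 <= \sum_v x v ^+ 2.

Lemma tree_deg_gt0 : (1 < #|V|)%N -> forall v, (0 < deg e v)%N.
Proof.
have [_ [_ conn] _] := e_tree.
move=> /card_gt1P[a [b [_ _ neq_ab]]] v; rewrite lt0n; apply/negP.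
move=> /eqP deg0; have no_nbr w : e v w = false.
  by have /card0_eq/(_ w) := deg0; rewrite inE.
have only w : w = v.
  have /connectP[[|x p] /= ep ->] := conn v w => //.
  by move: ep; rewrite no_nbr.
by rewrite (only a) (only b) eqxx in neq_ab.
Qed.

Lemma tree_energy_le (k : nat) :
  (0 < k)%N -> \sum_v weight r v = k%:R ->
  \sum_u \sum_(w | e u w) edge_energy r u w <=
    2 * \sum_v (minn (deg e v) k)%:R.
Proof.
have [[e_sym e_irr] _ e_acyclic] := e_tree => k_gt0 sum_weight.
case: k k_gt0 sum_weight => [//|[|k]] _ sum_weight.
  have [V_le1|V_gt1] := leqP #|V| 1.
    rewrite big1 ?mulr_ge0 ?sumr_ge0 // => u _; apply: big1 => w euw.
    by move: euw; rewrite (fintype_le1P V_le1 w u) e_irr.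
  (* Here k = 1 and all degrees are positive, so every [minn] is 1 and the right side is 2 [#|V|],
     the bound for the complete graph at total weight 1. *)
  apply: le_trans (total_energy_le r e) _.
  rewrite sum_weight mulr1 ler_pM2l // -sumr_const; apply: ler_sum => v _.
  by rewrite (minn_idPr (tree_deg_gt0 V_gt1 v)).
move: (k.+2) (isT : (1 < k.+2)%N) sum_weight => {}k k_gt1 sum_weight.
pose B := [set v | (k <= deg e v)%N].
pose M := nbrs e B; pose N := nbrs e (~: B).
have degE v : deg e v = (#|M v| + #|N v|)%N.
  rewrite /deg -(cardsID B); congr (_ + _)%N.
    by apply: eq_card => w; rewrite !inE andbC.
  by apply: eq_card => w; rewrite !inE.
have swap (f : V -> R) : \sum_(b in B) \sum_(s in N b) f s =
    \sum_(s in ~: B) #|M s|%:R * f s.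
  rewrite (exchange_big_dep (mem (~: B))) /=; last first.
    by move=> b s _; rewrite inE => /andP[].
  apply: eq_bigr => s sB; rewrite mulr_natl -sumr_const.
  by apply: eq_bigl => b; rewrite !inE e_sym; rewrite !inE in sB; rewrite sB.
(* E2 is twice the number of edges inside B. *)
pose E2 := (\sum_(b in B) #|M b|)%N.
have forest_B : B != set0 -> (E2 + 2 <= 2 * #|B|)%N.
  exact: card_nbrs_leq.
(* This is c + m(s) <= p doubled: the added vertex s contributes 2 on the right, which cancels the 2
   in [card_nbrs_leq]. *)
have forest_s s : s \in ~: B -> (E2 + 2 * #|M s| <= 2 * #|B|)%N.
  rewrite in_setC => sB.
  have := card_nbrs_leq e_sym e_irr e_acyclic (W := s |: B).
  rewrite sum_card_nbrs_setU1 // cardsU1 sB mulnDr addnC leq_add2l addnC.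
  by apply; apply/set0Pn; exists s; rewrite setU11.
have E2_le : (E2 <= 2 * #|B|)%N.
  have [B0|/forest_B] := eqVneq B set0; first by rewrite /E2 B0 big_set0.
  by apply: leq_trans; apply: leq_addr.
(* Edges between [B] and its complement are met from both ends; both visits are collected at the end
   in [B], whence the factor 2. *)
have splitE : \sum_u \sum_(w | e u w) edge_energy r u w =
    \sum_(u in B) \sum_(w in M u) edge_energy r u w +
    2 * (\sum_(u in B) \sum_(w in N u) edge_energy r u w) +
    \sum_(u in ~: B) \sum_(w in N u) edge_energy r u w.
  have split_nbr u : \sum_(w | e u w) edge_energy r u w =
      \sum_(w in M u) edge_energy r u w + \sum_(w in N u) edge_energy r u w.
    rewrite (bigID (mem B)) /=; congr (_ + _); apply: eq_bigl => w.
      by rewrite !inE andbC.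
    by rewrite !inE andbC.
  rewrite (eq_bigr _ (fun u _ => split_nbr u)) (bigID (mem B)) /=.
  rewrite !big_split /= -!addrA; congr (_ + _).
  rewrite mulr_natl mulr2n -!addrA; congr (_ + _); congr (_ + _); last first.
    by apply: eq_bigl => u; rewrite in_setC.
  rewrite (exchange_big_dep (mem B)) /=; last first.
    by move=> u w _; rewrite inE => /andP[].
  apply: eq_bigr => u uB; rewrite (eq_bigr _ (fun w _ => edge_energyC r w u)).
  by apply: eq_bigl => w; rewrite !inE e_sym; rewrite inE in uB; rewrite uB.
have T1 : \sum_(u in B) \sum_(w in M u) edge_energy r u w <= 2 * E2%:R.
  rewrite /E2 natr_sum mulr_sumr; apply: ler_sum => u _.
  rewrite mulr_natr -sumr_const; apply: ler_sum => w; rewrite inE => /andP[_ euw].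
  by apply: edge_energy_le2 => //; apply: contraTneq euw => ->; rewrite e_irr.
have T4 : \sum_(u in ~: B) \sum_(w in N u) edge_energy r u w <=
    2 * \sum_(u in ~: B) #|N u|%:R.
  rewrite mulr_sumr; apply: ler_sum => u _.
  rewrite mulr_natr -sumr_const; apply: ler_sum => w; rewrite inE => /andP[_ euw].
  by apply: edge_energy_le2 => //; apply: contraTneq euw => ->; rewrite e_irr.
have T2 : \sum_(u in B) \sum_(w in N u) edge_energy r u w <=
    \sum_(u in ~: B) #|M u|%:R + \sum_(u in B) weight r u +
    \sum_(u in ~: B) #|M u|%:R * weight r u.
  rewrite -swap; have <- : \sum_(u in B) #|N u|%:R = \sum_(u in ~: B) #|M u|%:R :> R.
    under [RHS]eq_bigr do rewrite -[_%:R]mulr1.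
    by rewrite -swap; apply: eq_bigr => u _; rewrite sumr_const.
  rewrite -!big_split; apply: ler_sum => u uB; apply: star_energy_le => //.
  by rewrite !inE e_irr andbF.
(* The total weight k is spread over the vertices and coefficients are compared: 2 [#|B|] - [E2] is
   at least 2 on [B] by [forest_B], and at least 2 [#|M u|] off [B] by [forest_s]. *)
have slack : 2 * (\sum_(u in B) weight r u) +
     2 * (\sum_(u in ~: B) #|M u|%:R * weight r u) <=
    (2 * #|B|%:R - E2%:R) * k%:R.
  rewrite -sum_weight !mulr_sumr [leRHS](bigID (mem B)) /=.
  apply: lerD.
    apply: ler_sum => u uB; apply: ler_wpM2r; first exact: weight_ge0.
    rewrite lerBrDl -natrM -natrD ler_nat; apply: forest_B.
    by apply/set0Pn; exists u.
  rewrite [leRHS](eq_bigl (mem (~: B))); last by move=> u; rewrite !inE.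
  apply: ler_sum => u uB; rewrite mulrA; apply: ler_wpM2r; first exact: weight_ge0.
  by rewrite lerBrDl -!natrM -natrD ler_nat forest_s.
have rhsE : \sum_v (minn (deg e v) k)%:R = #|B|%:R * k%:R +
    (\sum_(u in ~: B) #|M u|%:R + \sum_(u in ~: B) #|N u|%:R) :> R.
  rewrite (bigID (mem B)) /=; congr (_ + _).
    rewrite mulr_natl -sumr_const; apply: eq_bigr => u.
    by rewrite inE => /minn_idPr->.
  rewrite -big_split /=; apply: eq_big => u; first by rewrite !inE.
  by rewrite inE -ltnNge => /ltnW/minn_idPl->; rewrite degE natrD.
rewrite splitE rhsE.
(* The assumption k >= 2 enters here: the loss of [E2] times k in [slack] pays for the edges inside
   [B], bounded by [T1]. *)
have E2_small : 2 * E2%:R <= E2%:R * k%:R :> R.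
  by rewrite mulrC ler_wpM2l // ler_nat.
lra.
Qed.
End Bound.

(** * Partial sums of the conjugate degree sequence *)

Lemma sum_ltn_minn (d k : nat) : (\sum_(0 <= j < k) (j < d) = minn d k)%N.
Proof.
elim: k => [|k IHk]; first by rewrite big_geq ?minn0.
by rewrite big_nat_recr //= IHk /minn; case: (ltngtP k d); case: (ltngtP k.+1 d); lia.
Qed.

(** Double counting in the Ferrers diagram of the degrees: a vertex v fills [minn (deg e v) k] cells
    of the first k columns. *)
Lemma take_conj_degree (R : rcfType) (V : finType) (e : rel V) (k : nat) :
  (k <= #|V|)%N ->
  \sum_(x <- take k (conj_degree R e)) x = \sum_v (minn (deg e v) k)%:R.
Proof.
move=> le_kn; rewrite /conj_degree /mkseq -map_take take_iota (minn_idPl le_kn).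
rewrite big_map -[k in iota 0 k]subn0 -/(index_iota 0 k) -!natr_sum.
under eq_bigr do rewrite -sum1dep_card big_mkcond.
rewrite exchange_big /=; congr (_%:R); apply: eq_bigr => v _.
by rewrite -sum_ltn_minn; apply: eq_bigr => j _; case: (j < _)%N.
Qed.

Lemma sorted_conj_degree (R : rcfType) (V : finType) (e : rel V) :
  sorted >=%R (conj_degree R e).
Proof.
apply: (homo_sorted (e := leq)); last exact: iota_sorted.
move=> i j le_ij /=; rewrite ler_nat; apply/subset_leq_card/subsetP => v.
by rewrite !inE; apply: leq_ltn_trans.
Qed.

(** * The Laplacian form, the trace and the conclusion *)

Lemma sum_enum_rank (R : nmodType) (V : finType) (F : 'I_#|V| -> R) :
  \sum_i F i = \sum_v F (enum_rank v).
Proof. by rewrite (reindex enum_rank) //; apply/onW_bij/enum_rank_bij. Qed.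

(** Each edge gives two ordered pairs, whence the 2; by symmetry of [e] the squares at first ends
    and at second ends have the same sum. *)
Lemma laplacian_form (R : rcfType) (V : finType) (e : rel V)
    (y : 'rV[R]_#|V|) :
  symmetric e -> irreflexive e ->
  \sum_u \sum_(w | e u w) (y 0 (enum_rank u) - y 0 (enum_rank w)) ^+ 2 =
    2 * \sum_i \sum_j y 0 i * laplacian R e i j * y 0 j.
Proof.
move=> e_sym e_irr; pose z v := y 0 (enum_rank v).
rewrite sum_enum_rank (eq_bigr _ (fun u _ => sum_enum_rank _)) /=.
have inner u : \sum_w z u * laplacian R e (enum_rank u) (enum_rank w) * z w =
    \sum_(w | e u w) (z u ^+ 2 - z u * z w).
  rewrite sumrB sumr_const (bigD1 u) //= !mxE eqxx enum_rankK -sumrN.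
  congr (_ + _); first by rewrite /deg cardsE -mulr_natr; ring.
  rewrite [RHS]big_mkcond [RHS](bigD1 u) //= e_irr add0r; apply: eq_bigr => w.
  rewrite !mxE !enum_rankK (inj_eq enum_rank_inj) eq_sym => /negPf->.
  by case: ifP => _; ring.
rewrite (eq_bigr _ (fun u _ => inner u)).
have swap : \sum_u \sum_(w | e u w) z u ^+ 2 = \sum_u \sum_(w | e u w) z w ^+ 2.
  rewrite (exchange_big_dep predT) //=; apply: eq_bigr => u _.
  by apply: eq_bigl => w; rewrite e_sym.
have -> : 2 * (\sum_u \sum_(w | e u w) (z u ^+ 2 - z u * z w)) =
    \sum_u \sum_(w | e u w) z u ^+ 2 + \sum_u \sum_(w | e u w) z u ^+ 2
      - \sum_u \sum_(w | e u w) 2 * (z u * z w).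
  rewrite mulr_sumr -big_split -sumrB /=; apply: eq_bigr => u _.
  rewrite mulr_sumr -big_split -sumrB /=; apply: eq_bigr => w _.
  by ring.
rewrite {2}swap -big_split -sumrB /=; apply: eq_bigr => u _.
rewrite -big_split -sumrB /=; apply: eq_bigr => w _.
by rewrite /z; ring.
Qed.

Lemma size_spectrum (R : rcfType) (n : nat) (A : 'M[R]_n) (lam : seq R) :
  is_spectrum A lam -> size lam = n.
Proof.
by move=> [_ lamE]; have := size_char_poly A; rewrite lamE size_prod_XsubC => -[].
Qed.

Lemma sum_spectrum (R : rcfType) (n : nat) (A : 'M[R]_n) (lam : seq R) :
  is_spectrum A lam -> \sum_(x <- lam) x = \tr A.
Proof.
move=> A_lam; have size_lam := size_spectrum A_lam; case: A_lam => _ lamE.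
case: n A size_lam lamE => [|n] A size_lam lamE.
  by rewrite (size0nil size_lam) big_nil /mxtrace big_ord0.
apply: oppr_inj; rewrite -char_poly_trace // lamE -size_lam.
by rewrite coefPn_prod_XsubC // size_lam.
Qed.

Theorem corollary3p4p3 (R : rcfType) (V : finType) (e : rel V) (lam : seq R) :
  tree e ->
  is_spectrum (laplacian R e) lam ->
  majorized lam (conj_degree R e).
Proof.
move=> e_tree lam_spec; have [[e_sym e_irr] _ _] := e_tree.
have size_lam := size_spectrum lam_spec.
split; first by case: lam_spec.
- exact: sorted_conj_degree.
- by rewrite size_lam size_mkseq.
- move=> [|k]; first by rewrite !take0 !big_nil.
  rewrite size_lam => le_kn; rewrite take_conj_degree //.
  have [r [bessel norm_r <-]] :=
    spectral_frame (laplacian_sym R e_sym) lam_spec le_kn.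
  pose f (y : 'rV[R]_#|V|) v := y 0 (enum_rank v).
  have bessel_f (x : V -> R) :
      \sum_(y <- map f r) (\sum_v y v * x v) ^+ 2 <= \sum_v x v ^+ 2.
    have := bessel (\row_i x (enum_val i)); rewrite big_map.
    rewrite [leRHS]sum_enum_rank; under [leRHS]eq_bigr do rewrite mxE enum_rankK.
    apply: le_trans; apply: ler_sum => y _; rewrite sum_enum_rank.
    by under [X in _ <= X ^+ 2]eq_bigr do rewrite mxE enum_rankK.
  have norm_f : \sum_v weight (map f r) v = k.+1%:R.
    rewrite -norm_r /weight exchange_big big_map; apply: eq_bigr => y _.
    by rewrite sum_enum_rank.
  have := tree_energy_le e_tree bessel_f (ltn0Sn k) norm_f.
  have -> : \sum_u \sum_(w | e u w) edge_energy (map f r) u w = 2 *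
      \sum_(y <- r) \sum_i \sum_j y 0 i * laplacian R e i j * y 0 j.
    rewrite mulr_sumr; under [RHS]eq_bigr do rewrite -laplacian_form //.
    rewrite [RHS]exchange_big; apply: eq_bigr => u _.
    rewrite [RHS]exchange_big; apply: eq_bigr => w _.
    by rewrite /edge_energy big_map.
  by rewrite ler_pM2l.
(* Both totals are the sum of the degrees: the left is the trace, and at k = [#|V|] the truncation
   in [minn] has no effect. *)
- rewrite (sum_spectrum lam_spec) -[conj_degree R e]take_size.
  rewrite size_mkseq take_conj_degree // /mxtrace.
  rewrite sum_enum_rank; apply: eq_bigr => v _; rewrite mxE eqxx enum_rankK.
  by rewrite (minn_idPl (max_card _)).
Qed.
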